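(* Let $k>0$ and let $(X,d)$ be a complete $\mathrm{CAT}(k)$ space. Then $X$ is an absolute neighborhood retract.
   Context: For $k>0$ put $D_k=\pi/\sqrt{k}$, and let $M_k^2$ be the unit sphere $S^2$ with its angular metric divided by $\sqrt{k}$. A geodesic metric space $X$ is $\mathrm{CAT}(k)$ if every geodesic triangle in $X$ of perimeter less than $2D_k$ has a comparison triangle in $M_k^2$ (same side lengths) such that distances between points of the triangle are at most the distances between the corresponding comparison points. A metric space $X$ is an absolute neighborhood retract (ANR) if for every embedding (homeomorphism onto its image) $h$ of $X$ into a metric space $Y$ with $h(X)$ closed in $Y$, there are an open neighborhood $U$ of $h(X)$ in $Y$ and a retraction of $U$ onto $h(X)$, i.e. a continuous map $f:U\to h(X)$ which is the identity on $h(X)$. *)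

(* Defs.v *)
From HB Require Import structures.
From mathcomp Require Import all_boot all_order all_algebra.
From mathcomp Require Import all_classical all_reals all_analysis.
Set Implicit Arguments.
Unset Strict Implicit.
Unset Printing Implicit Defensive.
Import Order.TTheory GRing.Theory Num.Theory.
Import numFieldNormedType.Exports.
Local Open Scope classical_set_scope.
Local Open Scope ring_scope.

(* The library's [completeType] is pointed; completeness is stated here so that
   the empty space is not excluded. *)
Definition complete_space (R : realType) (X : metricType R) : Prop :=
  forall u : nat -> X, cauchy (u @ \oo) -> exists l : X, u @ \oo --> l.

(* Geodesics and triangles are defined relative to a distance function, so that
   they apply both to a [metricType] and to the model surface below. *)
Definition geodesic (R : realType) (T : Type) (d : T -> T -> R)
    (x y : T) (c : R -> T) : Prop :=
  [/\ c 0 = x, c (d x y) = y &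
      {in `[0, d x y] &, forall s t, d (c s) (c t) = `|s - t|}].

Definition geodesic_space (R : realType) (X : metricType R) : Prop :=
  forall x y : X, exists c : R -> X, geodesic mdist x y c.

(* [side i] joins [vertex i] to [vertex (i + 1 mod 3)]. *)
Record geodesic_triangle (R : realType) (T : Type) (d : T -> T -> R) :=
  GeodesicTriangle {
    vertex : 'I_3 -> T ;
    side : 'I_3 -> R -> T ;
    side_geodesic : forall i : 'I_3,
      geodesic d (vertex i) (vertex (ordS i)) (side i) }.

Definition side_length (R : realType) (T : Type) (d : T -> T -> R)
    (D : geodesic_triangle d) (i : 'I_3) : R :=
  d (vertex D i) (vertex D (ordS i)).

Definition perimeter (R : realType) (T : Type) (d : T -> T -> R)
    (D : geodesic_triangle d) : R :=
  \sum_(i < 3) side_length D i.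

Definition unit_sphere (R : realType) : set 'rV[R]_3 :=
  [set u | \sum_(i < 3) u 0 i ^+ 2 = 1].

(* The distance of M_k^2: the angle between unit vectors, divided by sqrt k. *)
Definition model_dist (R : realType) (k : R) (u v : @unit_sphere R) : R :=
  acos (\sum_(i < 3) set_val u 0 i * set_val v 0 i) / Num.sqrt k.

Definition model_diameter (R : realType) (k : R) : R := pi / Num.sqrt k.

(* Sides are parametrized by arc length, so the comparison point of
   [side D i s] is [side D' i s]. *)
Definition CAT (R : realType) (k : R) (X : metricType R) : Prop :=
  geodesic_space X /\
  forall D : geodesic_triangle (@mdist R X),
    perimeter D < 2 * model_diameter k ->
    exists D' : geodesic_triangle (model_dist k),
      (forall i, side_length D' i = side_length D i) /\
      forall (i j : 'I_3) (s t : R),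
        s \in `[0, side_length D i] -> t \in `[0, side_length D j] ->
        mdist (side D i s) (side D j t) <=
        model_dist k (side D' i s) (side D' j t).

Definition homeomorphism (S T : topologicalType) (f : S -> T) : Prop :=
  continuous f /\
  exists g : T -> S, [/\ continuous g, cancel f g & cancel g f].

(* [range h], used as a type, carries the topology induced by [Y]. *)
Definition to_range (X Y : Type) (h : X -> Y) (x : X) : range h :=
  exist _ (h x) (mem_set (imageT h x)).

Definition embedding (X Y : topologicalType) (h : X -> Y) : Prop :=
  homeomorphism (to_range h).

(* Only the values of [f] on [U] matter. *)
Definition retraction (Y : topologicalType) (U A : set Y) (f : Y -> Y) : Prop :=
  [/\ {within U, continuous f}, f @` U `<=` A & forall y, A y -> f y = y].

Definition ANR (R : realType) (X : metricType R) : Prop :=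
  forall (Y : metricType R) (h : X -> Y),
    embedding h -> closed (range h) ->
    exists U : set Y,
      [/\ open U, range h `<=` U & exists f : Y -> Y, retraction U (range h) f].

(* Main.v *)
Require Import Defs.
From mathcomp Require Import all_boot all_order all_algebra.
From mathcomp Require Import all_classical all_reals all_analysis.
From mathcomp Require Import ring lra.
Import Order.TTheory GRing.Theory Num.Theory.
Import numFieldNormedType.Exports.
Import metricType_numDomainType.
Local Open Scope classical_set_scope.
Local Open Scope ring_scope.
Set Implicit Arguments.
Unset Strict Implicit.
Unset Printing Implicit Defensive.

(** Let [h] embed [X] in [Y] as a closed set. A point [y] off [range h] but
    close to it should be sent to a point of [X] that represents those [z] for
    which [h z] is almost as close to [y] as possible. Dugundji's method would
    take a barycentre with weights from a partition of unity. Here one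
    variational problem replaces both. Put [gap y] for the distance from [y] to
    [range h], let [psi] be the cosine cut off at [pi / 2], and let

      [score y x = inf_z (gap y * psi (sqrt k * d(x, z)) + 2 * d(y, h z))].

    The image of [y] is the point that maximizes [score y] on [X].

    - Only the [z] with [d(y, h z) < 2 * gap y] matter for the infimum: the
      first summand is at most [gap y], so the others are beaten because of the
      factor 2. For [y] near [h z0] these [z] are near [z0], and an
      almost maximal [x] cannot be far from them ([near_max_close]). This gives
      continuity at the points of [range h].
    - On a small ball the cosine of the distance is uniformly concave. On the
      unit sphere, if [m] is the midpoint of [u] and [v], at angle [t] from
      both, then [u + v = 2 cos t * m], so that
      [<p,u> + <p,v> = 2 cos t * <p,m>] for all [p] ([sphere_midpoint]). The
      CAT(k) inequality turns this into an inequality in [X] ([CAT_midpoint]).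
      An infimum of uniformly concave functions is uniformly concave, so two
      almost maximal points of [score y] are close to each other
      ([near_max_small]), and completeness provides their common limit
      ([center_exists]).
    - [score] is Lipschitz in [y], uniformly in [x] ([score_lip]), so almost
      maximal points for [y'] are almost maximal for [y] when [y'] is near [y],
      and the limit depends continuously on [y] ([center_continuous]). *)

(** * Cosines and the unit sphere *)

Section Cosine.
Context {R : realType}.
Implicit Types s t : R.

Lemma cos_le_anti s t : 0 <= s -> s <= t -> t <= pi -> cos t <= cos s.
Proof.
move=> s0 st tpi; have [->//|/eqP nst] := eqVneq s t.
rewrite ltW// ltr_cos ?in_itv/= ?s0 ?tpi ?(le_trans s0)// ?(le_trans st)//.
by rewrite lt_neqAle st andbT; apply/eqP.
Qed.

Lemma sqr3_eq0 (a b c : R) : a ^+ 2 + b ^+ 2 + c ^+ 2 = 0 -> a = 0.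
Proof.
move=> h; apply/eqP; rewrite -sqrf_eq0 eq_le sqr_ge0 andbT.
by have := sqr_ge0 b; have := sqr_ge0 c; lra.
Qed.

End Cosine.

Section Sphere.
Context {R : realType}.
Implicit Types u v p m : @unit_sphere R.

Definition inner u v : R := \sum_(i < 3) set_val u 0 i * set_val v 0 i.

Lemma unit_sphereP u : \sum_(i < 3) set_val u 0 i ^+ 2 = 1.
Proof. by have := set_valP u. Qed.

(** Cauchy-Schwarz for unit vectors: [0 <= (u_i - v_i)^2 + ...] and
    [0 <= (u_i + v_i)^2 + ...]. *)
Lemma inner_itv u v : -1 <= inner u v <= 1.
Proof.
have := unit_sphereP u; have := unit_sphereP v.
rewrite /inner !big_ord_recr !big_ord0/= !add0r.
set u0 := set_val u 0 _; set u1 := set_val u 0 _; set u2 := set_val u 0 _.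
set v0 := set_val v 0 _; set v1 := set_val v 0 _; set v2 := set_val v 0 _.
move=> hv hu.
have := sqr_ge0 (u0 - v0); have := sqr_ge0 (u1 - v1).
have := sqr_ge0 (u2 - v2); have := sqr_ge0 (u0 + v0).
have := sqr_ge0 (u1 + v1); have := sqr_ge0 (u2 + v2).
by move=> *; apply/andP; split; nra.
Qed.

(** With [c] the cosine of the half angle, [2 c m - u - v] has square norm
    [4 c^2 + 2 + 2 (2 c^2 - 1) - 8 c^2 = 0], so [u + v = 2 c m]. *)
Lemma sphere_midpoint (c : R) u v m : inner u m = c -> inner m v = c ->
  inner u v = c ^+ 2 *+ 2 - 1 ->
  forall p, inner p u + inner p v = c *+ 2 * inner p m.
Proof.
move=> + + + p.
have := unit_sphereP u; have := unit_sphereP v; have := unit_sphereP m.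
rewrite /inner !big_ord_recr !big_ord0/= !add0r.
set u0 := set_val u 0 _; set u1 := set_val u 0 _; set u2 := set_val u 0 _.
set v0 := set_val v 0 _; set v1 := set_val v 0 _; set v2 := set_val v 0 _.
set m0 := set_val m 0 _; set m1 := set_val m 0 _; set m2 := set_val m 0 _.
move=> hm hv hu um mv uv.
have sq : (c *+ 2 * m0 - u0 - v0) ^+ 2 + (c *+ 2 * m1 - u1 - v1) ^+ 2
          + (c *+ 2 * m2 - u2 - v2) ^+ 2 = 0.
  have -> : (c *+ 2 * m0 - u0 - v0) ^+ 2 + (c *+ 2 * m1 - u1 - v1) ^+ 2
          + (c *+ 2 * m2 - u2 - v2) ^+ 2 =
    c ^+ 2 *+ 4 * (m0 ^+ 2 + m1 ^+ 2 + m2 ^+ 2)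
    + (u0 ^+ 2 + u1 ^+ 2 + u2 ^+ 2) + (v0 ^+ 2 + v1 ^+ 2 + v2 ^+ 2)
    + (u0 * v0 + u1 * v1 + u2 * v2) *+ 2
    - c *+ 4 * ((u0 * m0 + u1 * m1 + u2 * m2) + (m0 * v0 + m1 * v1 + m2 * v2)).
    by ring.
  by rewrite hm hv hu um mv uv; ring.
have e0 : c *+ 2 * m0 - u0 - v0 = 0 by exact: sqr3_eq0 sq.
have e1 : c *+ 2 * m1 - u1 - v1 = 0.
  by apply: sqr3_eq0; rewrite -[RHS]sq -addrA [RHS]addrAC [RHS]addrC.
have e2 : c *+ 2 * m2 - u2 - v2 = 0.
  by apply: sqr3_eq0; rewrite -[RHS]sq [RHS]addrC addrA.
have -> : u0 = c *+ 2 * m0 - v0 by lra.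
have -> : u1 = c *+ 2 * m1 - v1 by lra.
have -> : u2 = c *+ 2 * m2 - v2 by lra.
ring.
Qed.

End Sphere.

(** * Midpoints in CAT(k) spaces *)

Section Comparison.
Context {R : realType} (k : R).
Hypothesis k0 : 0 < k.
Local Notation sk := (Num.sqrt k).

Let sk0 : 0 < sk. Proof. by rewrite sqrtr_gt0. Qed.

Lemma cos_model_dist (u v : @unit_sphere R) :
  cos (sk * model_dist k u v) = inner u v.
Proof.
rewrite /model_dist mulrC divfK ?gt_eqF//.
by rewrite acosK// in_itv/=; exact: inner_itv.
Qed.

Lemma model_dist_le_pi (u v : @unit_sphere R) : sk * model_dist k u v <= pi.
Proof.
rewrite /model_dist mulrC divfK ?gt_eqF//.
exact/acos_lepi/inner_itv.
Qed.

(** The side from [x] to [y] is prescribed, so that one midpoint serves for all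
    opposite vertices [z]. *)
Lemma triangle_exists (X : metricType R) (c : R -> X) (x y z : X) :
  geodesic_space X -> geodesic mdist x y c ->
  exists D : geodesic_triangle (@mdist R X),
    [/\ vertex D 0 = z, vertex D 1 = x, vertex D 2 = y & side D 1 = c].
Proof.
move=> gX cxy; have [a azx] := gX z x; have [b byz] := gX y z.
pose V (i : 'I_3) := match val i with 0%N => z | 1%N => x | _ => y end.
pose S (i : 'I_3) := match val i with 0%N => a | 1%N => c | _ => b end.
have VS i : geodesic mdist (V i) (V (ordS i)) (S i).
  by case: i => -[|[|[|]]].
by exists (GeodesicTriangle VS).
Qed.

(** The midpoint [m] is chosen before [z]. In the comparison triangle
    [sphere_midpoint] gives equality, and replacing the comparison median by the
    shorter one in [X] increases its cosine. The cosine of half the side is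
    nonnegative because a side is at most half the perimeter. *)
Lemma CAT_midpoint (X : metricType R) : CAT k X -> forall x y : X,
  exists m : X, mdist x m = mdist x y / 2 /\
  forall z : X, sk * (mdist z x + mdist x y + mdist y z) < pi *+ 2 ->
    cos (sk * mdist x z) + cos (sk * mdist y z) <=
    cos (sk * mdist x y / 2) *+ 2 * cos (sk * mdist m z).
Proof.
move=> [gX catX] x y; have [c cxy] := gX x y.
have [c0 c1 cd] := cxy; set d := mdist x y.
have d0 : 0 <= d := mdist_ge0 _ _.
have hd : d / 2 \in `[0, d]%R by rewrite in_itv/=; apply/andP; split; lra.
have i0 : 0 \in `[0, d]%R by rewrite in_itv/= lexx.
have i1 : d \in `[0, d]%R by rewrite in_itv/= lexx andbT.
exists (c (d / 2)); split.
  by rewrite -{1}c0 cd// sub0r normrN ger0_norm ?divr_ge0.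
move=> z hz; have [D [D0 D1 D2 Dc]] := triangle_exists z gX cxy.
have S0 : ordS (0 : 'I_3) = 1 by apply: val_inj.
have S1 : ordS (1 : 'I_3) = 2 by apply: val_inj.
have S2 : ordS (2 : 'I_3) = 0 by apply: val_inj.
have L0 : side_length D 0 = mdist z x by rewrite /side_length S0 D0 D1.
have L1 : side_length D 1 = d by rewrite /side_length S1 D1 D2.
have L2 : side_length D 2 = mdist y z by rewrite /side_length S2 D2 D0.
have per : perimeter D < 2 * model_diameter k.
  rewrite /perimeter !big_ord_recr big_ord0/= add0r.
  rewrite [X in side_length D X](_ : _ = 0); last exact: val_inj.
  rewrite [X in _ + side_length D X + _](_ : _ = 1); last exact: val_inj.
  rewrite [X in _ + _ + side_length D X](_ : _ = 2); last exact: val_inj.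
  rewrite L0 L1 L2 /model_diameter mulrA ltr_pdivlMr// mulrC.
  by rewrite mulr_natl.
have [D' [E le]] := catX _ per.
have [p0 p1 pd] := side_geodesic D' 1.
have [q0 q1 qd] := side_geodesic D' 0.
pose u := vertex D' 1; pose v := vertex D' 2; pose p := vertex D' 0.
have F0 : model_dist k p u = mdist z x by rewrite -L0 -E /side_length S0.
have F1 : model_dist k u v = d by rewrite -L1 -E /side_length S1.
have F2 : model_dist k v p = mdist y z by rewrite -L2 -E /side_length S2.
set m := side D' 1 (d / 2).
rewrite S1 -/u -/v F1 in p0 p1 pd.
have um : model_dist k u m = d / 2.
  by rewrite -p0 pd// sub0r normrN ger0_norm ?divr_ge0.
have mv : model_dist k m v = d / 2.
  rewrite -p1 pd// distrC ger0_norm; lra.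
have := @sphere_midpoint R (cos (sk * d / 2)) u v m.
rewrite -!cos_model_dist um mv F1 -mulrA => /(_ erefl erefl).
rewrite -cos_mulr2n -mulrnAr -mulr_natr divfK// => /(_ erefl p).
rewrite -!cos_model_dist F0.
have symM a b : model_dist k a b = model_dist k b a.
  rewrite /model_dist; congr (acos _ / _).
  by apply: eq_bigr => i _; rewrite mulrC.
rewrite (symM p v) F2 metric_sym => ->.
have ch0 : 0 <= cos (sk * (d / 2)).
  rewrite mulrA; apply: cos_ge0_pihalf.
  have := metric_triangle x z y.
  rewrite (metric_sym x z) (metric_sym z y) -/d => dle.
  have : sk * d <= sk * (mdist z x + mdist y z) by rewrite ler_pM2l.
  have : 0 <= sk * d by rewrite mulr_ge0 ?sqrtr_ge0.
  move: hz; rewrite -/d.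
  have := pi_ge2 R; rewrite !mulrDr.
  move=> *; apply/andP; split; lra.
have pm : mdist z (c (d / 2)) <= model_dist k p m.
  have := le 0 1 0 (d / 2).
  rewrite Dc q0 L1 L0; have [-> _ _] := side_geodesic D 0; rewrite D0.
  by apply=> //; rewrite in_itv/= lexx/= mdist_ge0.
apply: ler_wpM2l; first by rewrite mulrn_wge0.
apply: cos_le_anti; first by rewrite mulr_ge0 ?mdist_ge0 ?sqrtr_ge0.
  by rewrite metric_sym ler_pM2l.
exact: model_dist_le_pi.
Qed.

End Comparison.

(** * Points of maximal score *)

Section Score.
Context {R : realType} {X Y : metricType R} (w : R) (h : X -> Y).
Hypothesis w0 : 0 < w.
Implicit Types (x z : X) (y : Y).

(** The cutoff makes the function antitone and nonnegative on all nonnegative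
    reals, so that points at any distance may enter the infimum. *)
Definition closeness (t : R) : R := cos (Num.min t (pi / 2)).

Definition gap y : R := inf (range (fun z => mdist y (h z))).

Definition term y x z : R :=
  gap y * closeness (w * mdist x z) + 2 * mdist y (h z).

Definition score y x : R := inf (range (term y x)).

Definition near_max y (eta : R) x : Prop :=
  forall x', score y x' <= score y x + eta.

(** The common limit of the almost maximal points, which stands in for a
    maximum: that the supremum of the score is attained is not known a
    priori. *)
Definition center y l : Prop := forall eps : R, 0 < eps ->
  exists2 eta, 0 < eta & forall x, near_max y eta x -> mdist x l <= eps.

Let scaled_ge0 x z : 0 <= w * mdist x z.
Proof. by rewrite mulr_ge0 ?mdist_ge0 ?(ltW w0). Qed.

Let scaled_triangle x x' z : w * mdist x z <= w * mdist x x' + w * mdist x' z.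
Proof. by rewrite -mulrDr ler_pM2l// metric_triangle. Qed.

Lemma closeness_ge0 t : 0 <= t -> 0 <= closeness t.
Proof.
move=> t0; apply: cos_ge0_pihalf; rewrite ge_min lexx orbT andbT.
by rewrite le_min; have := @pi_ge2 R => ?; apply/andP; split; lra.
Qed.

Lemma closenessE t : t <= 1 -> closeness t = cos t.
Proof.
by move=> t1; rewrite /closeness min_l//; have := pi_ge2 R; lra.
Qed.

Lemma closeness_le_anti s t : 0 <= s -> s <= t -> closeness t <= closeness s.
Proof.
move=> s0 st; have := pi_ge2 R => pi2; apply: cos_le_anti.
- by rewrite le_min s0; lra.
- by rewrite le_min !ge_min st lexx !orbT.
- by rewrite ge_min; apply/orP; right; lra.
Qed.

Lemma closeness_le1 t : closeness t <= 1.
Proof. exact: cos_le1. Qed.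

Section Gap.
Variable z0 : X.

Lemma gap_le y z : gap y <= mdist y (h z).
Proof.
by apply: ge_inf; [exists 0 => _ [? _ <-]; exact: mdist_ge0 | exists z].
Qed.

Lemma gap_ge (t : R) y : (forall z, t <= mdist y (h z)) -> t <= gap y.
Proof.
move=> tle; apply: lb_le_inf; first by exists (mdist y (h z0)), z0.
by move=> _ [z _ <-].
Qed.

Lemma gap_ge0 y : 0 <= gap y.
Proof. by apply: gap_ge => z; exact: mdist_ge0. Qed.

Lemma gap_lt y (t : R) : gap y < t -> exists z, mdist y (h z) < t.
Proof.
move=> gt; apply: contrapT => nex; move: gt; rewrite ltNge => /negP; apply.
apply: gap_ge => z; rewrite leNgt; apply/negP => zt; apply: nex.
by exists z.
Qed.

Lemma gap_lip y y' : gap y <= gap y' + mdist y y'.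
Proof.
rewrite -lerBlDr; apply: gap_ge => z; rewrite lerBlDr addrC.
exact: le_trans (gap_le _ z) (metric_triangle _ _ _).
Qed.

Lemma term_ge0 y x z : 0 <= term y x z.
Proof.
by rewrite addr_ge0 ?mulr_ge0 ?gap_ge0 ?closeness_ge0 ?mdist_ge0.
Qed.

Lemma score_le y x z : score y x <= term y x z.
Proof.
by apply: ge_inf; [exists 0 => _ [? _ <-]; exact: term_ge0 | exists z].
Qed.

Lemma score_ge y x (t : R) : (forall z, t <= term y x z) -> t <= score y x.
Proof.
move=> tle; apply: lb_le_inf; first by exists (term y x z0), z0.
by move=> _ [z _ <-].
Qed.

Lemma score_lip y y' x : score y x <= score y' x + 3 * mdist y y'.
Proof.
rewrite -lerBlDr; apply: score_ge => z; rewrite lerBlDr.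
apply: le_trans (score_le y x z) _; rewrite /term.
have := gap_lip y y'; have := metric_triangle y y' (h z).
have := closeness_ge0 (scaled_ge0 x z).
have := closeness_le1 (w * mdist x z); have := mdist_ge0 y y'.
set c := closeness _; set g := gap y; set g' := gap y'.
move=> d0 c1 c0 tri gle.
have : c * (g' + mdist y y' - g) >= 0 by rewrite mulr_ge0 ?subr_ge0.
have : (1 - c) * mdist y y' >= 0 by rewrite mulr_ge0 ?subr_ge0.
lra.
Qed.

(** Each term is at most [gap y + 2 * d(y, h z)]. *)
Lemma score_ub y x : score y x <= 3 * gap y.
Proof.
suff : (score y x - gap y) / 2 <= gap y by lra.
apply: gap_ge => z; have := score_le y x z; rewrite /term.
have : gap y * (1 - closeness (w * mdist x z)) >= 0.
  by rewrite mulr_ge0 ?gap_ge0 ?subr_ge0 ?closeness_le1.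
lra.
Qed.

Lemma near_max_exists y (eta : R) : 0 < eta -> exists x, near_max y eta x.
Proof.
move=> eta0; pose S := range (score y).
have ubS : ubound S (3 * gap y) by move=> _ [x _ <-]; exact: score_ub.
have supS : has_sup S by split; [exists (score y z0), z0 | exists (3 * gap y)].
have [_ [x _ <-] hx] := sup_adherent eta0 supS.
exists x => x'; rewrite -lerBlDr; apply: le_trans (ltW hx); rewrite lerB//.
by apply: ub_le_sup; [exists (3 * gap y) | exists x'].
Qed.

Lemma near_max_le y (eta eta' : R) x :
  eta <= eta' -> near_max y eta x -> near_max y eta' x.
Proof. by move=> le xmax x'; apply: le_trans (xmax x') _; rewrite lerD2l. Qed.

(** Any sequence of [1 / (n + 1)]-maximal points is Cauchy. *)
Lemma center_exists y : complete_space X ->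
  (forall eps : R, 0 < eps -> exists2 eta, 0 < eta &
    forall x x', near_max y eta x -> near_max y eta x' -> mdist x x' <= eps) ->
  exists l, center y l.
Proof.
move=> cX small.
have inv0 n : 0 < n.+1%:R^-1 :> R by rewrite invr_gt0.
have [u umax] := choice (fun n => near_max_exists y (inv0 n)).
have umaxN (eta : R) : 0 < eta -> \forall n \near \oo, near_max y eta (u n).
  move=> eta0; near=> n; apply: near_max_le (umax n); apply: ltW.
  by near: n; exact: near_infty_natSinv_lt (PosNum eta0).
have [l ul] : exists l : X, u @ \oo --> l.
  apply: cX; apply/cauchy_ballP => eps eps0; have [] := small (eps / 2).
    by rewrite divr_gt0.
  move=> eta eta0 small_eta; near_simpl.
  near=> n m; rewrite ballEmdist/=.
  apply: (@le_lt_trans _ _ (eps / 2)); last lra.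
  by apply: small_eta; [near: n | near: m]; exact: umaxN.
exists l => eps eps0; have [] := small (eps / 2); first by rewrite divr_gt0.
move=> eta eta0 small_eta; exists eta => // x xmax.
have ul2 : \forall n \near \oo, mdist l (u n) < eps / 2.
  by move/cvgrPdist_lt: ul; apply; rewrite divr_gt0.
near \oo => n; have := metric_triangle x (u n) l; rewrite (metric_sym (u n)).
have : mdist l (u n) < eps / 2 by near: n.
have : mdist x (u n) <= eps / 2.
  by apply: small_eta => //; near: n; exact: umaxN.
lra.
Unshelve. all: by end_near. Qed.

(** If [d(y, y')] is small against [eta], an almost maximal point for [y'] is
    [eta]-maximal for [y], hence close to both centers. *)
Lemma center_continuous y l : center y l -> forall eps : R, 0 < eps ->
  exists2 r : R, 0 < r &
    forall y' l', mdist y y' < r -> center y' l' -> mdist l l' <= eps.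
Proof.
move=> cl eps eps0; have e2 : 0 < eps / 2 by rewrite divr_gt0.
have [eta eta0 lP] := cl _ e2.
(* Two uses of the Lipschitz constant 3 cost [6 * (eta / 12) = eta / 2]. *)
exists (eta / 12) => [|y' l' yy' cl']; first by rewrite divr_gt0.
have [eta' eta'0 l'P] := cl' _ e2.
have [|x xmax] := @near_max_exists y' (Num.min eta' (eta / 2)).
  by rewrite lt_min eta'0 divr_gt0.
have xl' := l'P x (near_max_le _ xmax).
have xl : mdist x l <= eps / 2.
  apply: lP => x'; have := score_lip y y' x'; have := score_lip y' y x.
  have := near_max_le (_ : _ <= eta / 2) xmax x'; rewrite ge_min lexx orbT.
  move=> /(_ isT); rewrite (metric_sym y' y); lra.
have := metric_triangle l x l'; rewrite (metric_sym l x).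
have := xl' _; rewrite ge_min lexx => /(_ isT); lra.
Qed.

End Gap.

(** The score of [z0] is at least [gap y * (cos rho + 2)]. If [x] is almost as
    good, its term at a [z] that almost realizes the gap forces
    [closeness (w * d(x, z))] above [cos (2 * rho)]. *)
Lemma near_max_close (rho : R) y z0 : 0 < rho -> 2 * rho <= 1 -> 0 < gap y ->
  (forall z, mdist y (h z) < 2 * gap y -> w * mdist z z0 <= rho) ->
  exists2 eta, 0 < eta &
    forall x, near_max y eta x -> w * mdist x z0 <= 3 * rho.
Proof.
move=> rho0 rho1 g0 near_z0; set g := gap y in g0 near_z0 *.
have drop : cos (2 * rho) < cos rho.
  by rewrite ltr_cos ?in_itv/=; have := pi_ge2 R => ?; first lra;
    apply/andP; split; lra.
exists (g * (cos rho - cos (2 * rho)) / 3) => [|x xmax].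
  by rewrite divr_gt0// mulr_gt0// subr_gt0.
set eta := _ / 3 in xmax.
have eta_lt : 2 * eta < 2 * g.
  have := cos_le1 rho; have : 0 <= cos (2 * rho).
    by rewrite -closenessE// closeness_ge0// mulr_ge0// ltW.
  move=> c0 c1; have : g * (1 - (cos rho - cos (2 * rho))) >= 0.
    by rewrite mulr_ge0 ?(ltW g0)//; lra.
  rewrite /eta; lra.
have z0_score : g * cos rho + 2 * g <= score y z0.
  apply: (score_ge z0) => z; rewrite /term -/g.
  have [near|far] := ltP (mdist y (h z)) (2 * g).
    apply: lerD; last by rewrite ler_pM2l//; exact: gap_le.
    rewrite ler_pM2l// -closenessE; last lra.
    by apply: closeness_le_anti => //; rewrite metric_sym; exact: near_z0.
  have : 0 <= g * (1 - cos rho).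
    by rewrite mulr_ge0 ?(ltW g0)// subr_ge0 cos_le1.
  have : 0 <= g * closeness (w * mdist z0 z).
    by rewrite mulr_ge0 ?(ltW g0)// closeness_ge0.
  lra.
have eta0 : 0 < eta by rewrite divr_gt0// mulr_gt0// subr_gt0.
have [z zlt] : exists z, mdist y (h z) < g + eta.
  by apply: (gap_lt z0); rewrite ltrDl.
have zz0 : w * mdist z z0 <= rho by apply: near_z0; lra.
have xz : closeness (2 * rho) < closeness (w * mdist x z).
  rewrite -(ltr_pM2l g0) closenessE//.
  have := xmax z0; have := score_le z0 y x z; rewrite /term -/g.
  have : eta * 3 = g * (cos rho - cos (2 * rho)) by rewrite divfK.
  lra.
have : w * mdist x z < 2 * rho.
  rewrite ltNge; apply/negP => le.
  have rho20 : 0 <= 2 * rho by rewrite mulr_ge0 ?ltW.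
  by have := closeness_le_anti rho20 le; rewrite leNgt xz.
have := scaled_triangle x z z0; lra.
Qed.

(** The conclusion of [CAT_midpoint]: medians are at most as long as on a
    sphere of radius [1 / w]. *)
Definition has_round_midpoints := forall x x', exists m,
  mdist x m = mdist x x' / 2 /\
  forall z, w * (mdist z x + mdist x x' + mdist x' z) < pi *+ 2 ->
    cos (w * mdist x z) + cos (w * mdist x' z) <=
    cos (w * mdist x x' / 2) *+ 2 * cos (w * mdist m z).

(** Let [m] be the midpoint of [x] and [x'], and [c] the cosine of half their
    scaled distance. By concavity the score of [m] exceeds the mean of the
    scores of [x] and [x'] by at least [gap y * cos (4 / 10) * (1 - c)]; for
    [eta]-maximal points this excess is at most [eta], so [c] is close to 1. *)
Lemma near_max_small y z0 : has_round_midpoints -> 0 < gap y ->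
  (forall z, mdist y (h z) < 2 * gap y -> w * mdist z z0 <= 10^-1) ->
  forall eps : R, 0 < eps -> exists2 eta, 0 < eta &
    forall x x', near_max y eta x -> near_max y eta x' -> mdist x x' <= eps.
Proof.
move=> round g0 near_z0 eps eps0; have pi2 := pi_ge2 R.
have [|//|eta1 eta10 close] := near_max_close _ _ g0 near_z0; [lra|lra|].
set g := gap y in g0 near_z0 *.
(* With radius 1/10, [x] and [x'] are within 3/10 of [z0], hence within 4/10 of
   the relevant [z], and [m] within 7/10, where cosines are still positive. *)
pose kap : R := cos (4 / 10).
have kap0 : 0 < kap by apply: cos_gt0_pihalf; apply/andP; split; lra.
pose e := Num.min (w * eps / 2) 1.
have e0 : 0 < e by rewrite lt_min ltr01 divr_gt0 ?mulr_gt0.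
have e1 : e <= 1 by rewrite ge_min lexx orbT.
have cose : cos e < 1.
  by rewrite -cos0 ltr_cos ?in_itv/= ?lexx//; [|apply/andP; split]; lra.
pose eta := Num.min eta1 (g * kap * (1 - cos e) / 2).
exists eta => [|x x' xmax x'max].
  by rewrite lt_min eta10 divr_gt0// !mulr_gt0// subr_gt0.
have eta_le1 : eta <= eta1 by rewrite ge_min lexx.
have eta_le2 : eta <= g * kap * (1 - cos e) / 2 by rewrite ge_min lexx orbT.
have xz0 := close _ (near_max_le eta_le1 xmax).
have x'z0 := close _ (near_max_le eta_le1 x'max).
have xx' := scaled_triangle x z0 x'; rewrite (metric_sym z0) in xx'.
have [m [xm mround]] := round x x'.
set c := cos (w * mdist x x' / 2) in mround.
have xx'0 := scaled_ge0 x x'.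
have c0 : 0 <= c by apply: cos_ge0_pihalf; apply/andP; split; lra.
have c1 : c <= 1 := cos_le1 _.
have m_score : (score y x + score y x') / 2 + g * kap * (1 - c) <= score y m.
  apply: (score_ge z0) => z; have [near|far] := ltP (mdist y (h z)) (2 * g).
    have zz0 := near_z0 z near.
    have xz := scaled_triangle x z0 z; rewrite (metric_sym z0) in xz.
    have x'z := scaled_triangle x' z0 z; rewrite (metric_sym z0) in x'z.
    have mz := scaled_triangle m x z; rewrite (metric_sym m x) xm in mz.
    have xz_ge := scaled_ge0 x z; have x'z_ge := scaled_ge0 x' z.
    have mz_ge := scaled_ge0 m z.
    have := mround z; rewrite !mulrDr (metric_sym z x) => mz_concave.
    have {mz_concave} := mz_concave ltac:(lra).
    have : kap <= cos (w * mdist x z) by apply: cos_le_anti; lra.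
    have : kap <= cos (w * mdist x' z) by apply: cos_le_anti; lra.
    have : 0 <= cos (w * mdist m z).
      by apply: cos_ge0_pihalf; apply/andP; split; lra.
    have := score_le z0 y x z; have := score_le z0 y x' z; rewrite /term -/g.
    rewrite !closenessE; try lra.
    set a := cos _; set b := cos _; set M := cos _ => sx' sx M0 kb ka abM.
    have kM : kap <= M.
      by have : 0 <= (1 - c) * M; [rewrite mulr_ge0 ?subr_ge0 | lra].
    have : (1 - c) * (M - kap) >= 0 by rewrite mulr_ge0 ?subr_ge0.
    move=> ineq; have : g * (M - (a + b) / 2 - kap * (1 - c)) >= 0.
      by rewrite mulr_ge0 ?(ltW g0)//; lra.
    lra.
  (* A far [z] contributes at least [4 * g]; scores are at most [3 * g]. *)
  have := score_ub z0 y x; have := score_ub z0 y x'; rewrite -/g.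
  have kap1 : kap <= 1 := cos_le1 _.
  have : g * (1 - kap * (1 - c)) >= 0.
    rewrite mulr_ge0 ?(ltW g0)// subr_ge0.
    by rewrite mulr_ile1 ?subr_ge0 ?(ltW kap0)//; lra.
  have : 0 <= g * closeness (w * mdist m z).
    by rewrite mulr_ge0 ?(ltW g0)// closeness_ge0.
  rewrite /term -/g; lra.
have gk0 : 0 < g * kap by rewrite mulr_gt0.
have ce : 1 - c <= (1 - cos e) / 2.
  by rewrite -(ler_pM2l gk0); have := xmax m; have := x'max m; lra.
rewrite leNgt; apply/negP => far.
suff : c <= cos e by lra.
have far' : w * eps <= w * mdist x x' by rewrite ler_pM2l// ltW.
apply: cos_le_anti; [lra| |lra].
by rewrite ge_min; apply/orP; left; lra.
Qed.

End Score.

(** * The retraction *)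

Section Retraction.
Context {R : realType} {X Y : metricType R} (w : R) (h : X -> Y).
Hypothesis w0 : 0 < w.
Hypothesis hemb : embedding h.
Hypothesis hclosed : closed (range h).
Implicit Types (x z : X) (y : Y).

Lemma embedding_continuous : continuous h.
Proof.
case: hemb => ch _ x; have -> : h = set_val \o to_range h by [].
by apply: continuous_comp; [exact: ch | exact: initial_continuous].
Qed.

Lemma embedding_inverse_continuous (z0 : X) (eps : R) : 0 < eps ->
  exists2 r, 0 < r & forall z, mdist (h z0) (h z) < r -> mdist z0 z < eps.
Proof.
move=> eps0; case: hemb => _ [g [cg hK _]].
have := cg (to_range h z0) (ball z0 eps); rewrite hK => gz0.
have : nbhs (to_range h z0) (g @^-1` ball z0 eps).
  by apply: gz0; exact: (nbhsx_ballx _ _ eps0).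
rewrite nbhsE => -[B [[A oA <-] Az0] sub].
have : nbhs (h z0) A by exact: open_nbhs_nbhs.
move/nbhs_mdistP => -[r r0 rA]; exists r => // z hz.
have /sub/= : (set_val @^-1` A) (to_range h z) by exact: rA.
by rewrite hK ballEmdist.
Qed.

Lemma gap_gt0 (z0 : X) y : ~ range h y -> 0 < gap h y.
Proof.
move=> yh; have oC := closed_openC hclosed.
have : nbhs y (~` range h) by exact: open_nbhs_nbhs.
move/nbhs_mdistP => -[r r0 rC]; apply: lt_le_trans r0 _.
apply: (gap_ge z0) => z; rewrite leNgt; apply/negP => /rC; apply.
by exists z.
Qed.

(** The neighbourhood of [range h] on which centers exist: by
    [near_image] all relevant [z] lie in one ball of scaled radius 1/10. *)
Definition tame y := exists (z0 : X) (r : R),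
  [/\ 0 < r, mdist (h z0) y < r &
      forall z, mdist (h z0) (h z) < 3 * r -> w * mdist z z0 <= 10^-1].

(** Holds since [gap h y <= d(y, h z0) < r]. *)
Lemma near_image (r : R) (z0 : X) y z : mdist (h z0) y < r ->
  mdist y (h z) < 2 * gap h y -> mdist (h z0) (h z) < 3 * r.
Proof.
move=> yr yz; have := gap_le h y z0; have := metric_triangle (h z0) y (h z).
rewrite (metric_sym y (h z0)); lra.
Qed.

Lemma tame_open : open tame.
Proof.
rewrite openE => y [z0 [r [r0 yr rP]]]; apply/nbhs_mdistP.
exists (r - mdist (h z0) y) => /=; first by rewrite subr_gt0.
move=> y' /= yy'; exists z0, r; split => //.
have := metric_triangle (h z0) y y'; lra.
Qed.

Lemma tame_range : range h `<=` tame.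
Proof.
move=> _ [z0 _ <-].
have [|r r0 rP] := @embedding_inverse_continuous z0 (10^-1 / w).
  by rewrite divr_gt0// invr_gt0.
exists z0, (r / 3); split; rewrite ?mdistxx ?divr_gt0// => z hz.
rewrite mulrC -ler_pdivlMr// metric_sym ltW// rP//; lra.
Qed.

(** Both cases are needed: on [range h] the gap vanishes, the score is
    identically 0, and it does not single out a point. *)
Definition target y x : Prop := h x = y \/ (~ range h y /\ center w h y x).

(** Valued in [Y] with a default, as [X] may be empty. *)
Definition retract y : Y :=
  if pselect (exists x, target y x) is left e then h (projT1 (cid e)) else y.

Lemma retract_range z : retract (h z) = h z.
Proof.
rewrite /retract; case: pselect => // e; case: cid => x /= [//|[nz _]].
by case: nz; exists z.
Qed.

Hypothesis hcomplete : complete_space X.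
Hypothesis hround : @has_round_midpoints R X w.

Lemma retractP y : tame y -> exists2 x, target y x & retract y = h x.
Proof.
move=> [z0 [r [r0 yr rP]]].
have e : exists x, target y x.
  have [[z _ <-]|ny] := pselect (range h y); first by exists z; left.
  have [l lP] : exists l, center w h y l.
    apply: (center_exists w0 z0) => //; apply: near_max_small => //.
      exact: gap_gt0 ny.
    by move=> z yz; exact: rP (near_image yr yz).
  by exists l; right.
rewrite /retract; case: pselect => // e'; case: cid => x /= xP.
by exists x.
Qed.

(** For [y] near [h z0] all relevant [z] are near [z0], so [near_max_close]
    places the center near [z0]. *)
Lemma center_near_range (z0 : X) (eps : R) : 0 < eps -> exists2 r, 0 < r &
  forall y l, mdist (h z0) y < r -> ~ range h y -> center w h y l ->
  mdist z0 l <= eps.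
Proof.
move=> eps0; have eps4 : 0 < eps / 4 by rewrite divr_gt0.
pose rho := Num.min (w * (eps / 4)) (1 / 2).
have rho0 : 0 < rho by rewrite lt_min mulr_gt0 //=; lra.
have rho1 : 2 * rho <= 1.
  have : rho <= 1 / 2 by rewrite ge_min lexx orbT.
  lra.
have rhoe : rho <= w * (eps / 4) by rewrite ge_min lexx.
have [|r r0 rP] := @embedding_inverse_continuous z0 (rho / w).
  by rewrite divr_gt0.
exists (r / 3) => [|y l yr ny cl]; first by rewrite divr_gt0.
have [|eta eta0 close] :=
  near_max_close w0 rho0 rho1 (gap_gt0 z0 ny) (z0 := z0).
  move=> z yz; rewrite mulrC -ler_pdivlMr// metric_sym ltW// rP//.
  by have := near_image yr yz; lra.
have [eta' eta'0 lP] := cl _ eps4.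
have [|x xmax] := near_max_exists h w0 z0 y (eta := Num.min eta eta').
  by rewrite lt_min eta0.
have xz0 : w * mdist x z0 <= w * (3 * (eps / 4)).
  apply: (@le_trans _ _ (3 * rho)); last lra.
  by apply: close; apply: near_max_le xmax; rewrite ge_min lexx.
rewrite ler_pM2l// in xz0.
have : mdist x l <= eps / 4.
  by apply: lP; apply: near_max_le xmax; rewrite ge_min lexx orbT.
have := metric_triangle z0 x l; rewrite (metric_sym z0 x); lra.
Qed.

(** Near a point off the closed set [range h] only centers occur; near a point
    of [range h] a target is a preimage under [h] or a center. *)
Lemma target_continuous y x (eps : R) : target y x -> 0 < eps ->
  exists2 r, 0 < r & forall y' x',
    mdist y y' < r -> target y' x' -> mdist x x' <= eps.
Proof.
move=> [<-|[ny cx]] eps0.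
  have [r r0 rP] := embedding_inverse_continuous x eps0.
  have [r' r'0 r'P] := center_near_range x eps0.
  exists (Num.min r r') => [|y' x']; first by rewrite lt_min r0.
  rewrite lt_min => /andP[yr yr'] [y'E|[ny' cx']].
    by rewrite ltW// rP// y'E.
  exact: r'P cx'.
have [r r0 rP] := center_continuous w0 x cx eps0.
exists (Num.min r (gap h y)) => [|y' x'].
  by rewrite lt_min r0 (gap_gt0 x).
rewrite lt_min => /andP[yr yg] [y'E|[_ cx']]; last exact: rP cx'.
by move: yg; rewrite -y'E ltNge gap_le.
Qed.

Lemma retract_continuous y : tame y -> {for y, continuous retract}.
Proof.
move=> ty; have [x xy retE] := retractP ty.
rewrite /prop_for /continuous_at retE.
apply/cvgrPdist_lt => eps eps0.
have : nbhs x [set x' | mdist (h x) (h x') < eps].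
  by have /cvgrPdist_lt := @embedding_continuous x; apply.
move/nbhs_mdistP => -[d /= d0 dP].
have [|r r0 rP] := target_continuous xy (eps := d / 2).
  by rewrite divr_gt0.
near=> y'; have [|x' x'y' ->] := @retractP y'.
  by near: y'; apply: open_nbhs_nbhs; split => //; exact: tame_open.
apply: dP => /=; apply: (@le_lt_trans _ _ (d / 2)); last lra.
apply: rP x'y'; near: y'; apply/nbhs_mdistP; exists r => //=.
Unshelve. all: by end_near. Qed.

End Retraction.

Theorem corollary3 (R : realType) (k : R) (X : metricType R)
    (hk : 0 < k) (hcomplete : complete_space X) (hCAT : CAT k X) :
  ANR X.
Proof.
move=> Y h hemb hclosed; have w0 : 0 < Num.sqrt k by rewrite sqrtr_gt0.
exists (tame (Num.sqrt k) h); split.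
- exact: tame_open.
- exact: tame_range.
exists (retract (Num.sqrt k) h).
have round := CAT_midpoint hk hCAT.
split => [|_ [y ty <-]|_ [z _ <-]].
- by apply: continuous_in_subspaceT => y /set_mem; exact: retract_continuous.
- by have [x _ ->] := retractP w0 hclosed hcomplete round ty; exists x.
- exact: retract_range.
Qed.
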